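(* Let $(\Omega,d)$ be a proper metric space and $p\ge1$. Then $\mathcal{P}_p(\Omega;d)$ equipped with the $p$-Wasserstein metric $W_p$ has the input-EDAP.
   Context: A metric space $(\Omega,d)$ is proper if every closed ball $\{x\in\Omega: d(x,x_0)\le R\}$ ($R>0$, $x_0\in\Omega$) is compact. $\mathcal{P}_p(\Omega;d)$ is the set of Borel probability measures $\mu$ on $\Omega$ with $\int_\Omega d(x,x_0)^p\,\mathrm{d}\mu(x)<\infty$ for some (hence any) $x_0\in\Omega$. The $p$-Wasserstein metric is $W_p(\mu,\nu)=\big(\inf_{\pi\in\Pi(\mu,\nu)}\int_{\Omega\times\Omega}d(x,y)^p\,\mathrm{d}\pi(x,y)\big)^{1/p}$, where $\Pi(\mu,\nu)$ is the set of Borel probability measures on $\Omega\times\Omega$ with first marginal $\mu$ and second marginal $\nu$. Input-EDAP (for $\mathbb{K}\in\{\mathbb{R},\mathbb{C}\}$): a metric space $(\mathcal{X},\rho)$ has the input-EDAP if there are mappings $E_n:\mathcal{X}\to\mathbb{K}^{w(n)}$ (possibly discontinuous, $w(n)\in\mathbb{N}$) and $D_n:\overline{E_n(\mathcal{X})}\to\mathcal{X}$, $n\in\mathbb{N}$, such that: (i) there is $r:\mathbb{N}\to(0,\infty)$ such that for each compact $K\subseteq\mathcal{X}$ there is $N_K\in\mathbb{N}$ with $\sup_{f\in K}|E_n(f)|\le r(n)$ for all $n\ge N_K$; (ii) each $D_n$ is continuous; (iii) for every compact $K\subseteq\mathcal{X}$, $\sup_{f\in K}\rho(f,D_n(E_n(f)))\to0$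 as $n\to\infty$. *)

(* Defs.v *)
From HB Require Import structures.
From mathcomp Require Import all_boot all_order all_algebra.
From mathcomp Require Import complex.
From mathcomp Require Import all_classical all_reals all_analysis.

Set Implicit Arguments.
Unset Strict Implicit.
Unset Printing Implicit Defensive.

Import Order.TTheory GRing.Theory Num.Theory.
Import numFieldNormedType.Exports.

Local Open Scope classical_set_scope.
Local Open Scope ring_scope.

(* Measurable types are pointed, hence the metric space that carries the
   measures is pointed, that is, nonempty. *)
#[short(type="pmetricType")]
HB.structure Definition PointedMetric (R : numDomainType) :=
  {T of Pointed T & Metric R T}.

Definition proper_metric (R : realType) (T : metricType R) : Prop :=
  forall (x0 : T) (r : R), 0 < r -> compact [set x | mdist x x0 <= r].

(* [dist_space rho] is [X] with the topology of the distance [rho]: a set is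
   open iff it contains a [rho]-ball around each of its points. [rho] is a bare
   function because this family of sets is a topology for every [rho];
   [dist_space_openE] below says that for the distance of a [metricType] it is
   the topology of that [metricType]. *)
Definition dist_space (R : realType) (X : Type) (rho : X -> X -> R) : Type := X.

Definition dist_open (R : realType) (X : Type) (rho : X -> X -> R) :
    set_system X :=
  [set U | forall x, U x ->
     exists2 e : R, 0 < e & [set y | rho x y < e] `<=` U].

Section dist_space_topology.
Context (R : realType) (X : Type) (rho : X -> X -> R).

Let dist_openT : dist_open rho setT.
Proof. by move=> x _; exists 1. Qed.

Let dist_openI : setI_closed (dist_open rho).
Proof.
move=> U V oU oV x [/oU[e e0 eU] /oV[d d0 dV]].
exists (Num.min e d); first by rewrite lt_min e0.
by move=> y /=; rewrite lt_min => /andP[? ?]; split; [exact: eU|exact: dV].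
Qed.

Let dist_open_bigU (I : Type) (f : I -> set X) :
  (forall i, dist_open rho (f i)) -> dist_open rho (\bigcup_i f i).
Proof.
move=> fo x [i _ /fo[e e0 ef]]; exists e => // y xy.
by exists i => //; exact: ef.
Qed.

HB.instance Definition _ := gen_eqMixin (dist_space rho).
HB.instance Definition _ := gen_choiceMixin (dist_space rho).
HB.instance Definition _ := isOpenTopological.Build (dist_space rho)
  dist_openT dist_openI dist_open_bigU.

End dist_space_topology.

Lemma dist_space_openE (R : realType) (T : metricType R) (U : set T) :
  @open (dist_space (@mdist R T)) U <-> @open T U.
Proof.
have -> : @open (dist_space (@mdist R T)) = dist_open (@mdist R T) by [].
rewrite openE; split=> [oU x /oU[e e0 eU]|oU x /oU].
  apply/nbhs_ballP; exists e => // y; rewrite ballEmdist; exact: eU.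
move=> /nbhs_ballP[e /= e0 eU]; exists e => // y xy; apply: eU.
by rewrite ballEmdist.
Qed.

(* [absK] is the modulus of [K] with values in [R]; the norm that the library
   puts on ['rV[K]_w] is the maximum norm. *)
Definition eucl_norm (R : realType) (K : numFieldType) (absK : K -> R)
    (w : nat) (v : 'rV[K]_w) : R :=
  Num.sqrt (\sum_(i < w) absK (v 0 i) ^+ 2).

(* [E x] as an element of the closure of the range of [E] *)
Definition code (X : Type) (Y : topologicalType) (E : X -> Y) (x : X) :
    closure (range E) :=
  exist _ (E x) (mem_set (subset_closure (imageT E x))).

(* [D n] is defined on the subtype [closure (range (E n))] only, with its
   subspace topology. [A] is nonempty in the last clause because the supremum
   of the empty set in [\bar R] is [-oo]. *)
Definition input_EDAP (R : realType) (K : numFieldType) (absK : K -> R)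
    (X : Type) (rho : X -> X -> R) : Prop :=
  exists (w : nat -> nat) (E : forall n, X -> 'rV[K]_(w n))
         (D : forall n, closure (range (E n)) -> X),
  [/\ exists2 r : nat -> R, forall n, 0 < r n &
        forall A : set (dist_space rho), compact A ->
          exists N : nat, forall n, (N <= n)%N ->
            forall f, A f -> eucl_norm absK (E n f) <= r n,
      forall n, continuous (D n : closure (range (E n)) -> dist_space rho) &
      forall A : set (dist_space rho), compact A -> A !=set0 ->
        ereal_sup [set (rho f (D n (code (E n) f)))%:E | f in A]
          @[n --> \oo] --> 0%E].

Lemma probability_eq (d : measure_display) (T : measurableType d)
    (R : realType) (P Q : probability T R) :
  (P : set T -> \bar R) = Q -> P = Q.
Proof.
destruct P as [f [[a b] a2 a3 a4 a5 a6 a7]].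
destruct Q as [g [[a' b'] b2 b3 b4 b5 b6 b7]] => /= fg; subst g; f_equal.
have ? : a = a' by exact: Prop_irrelevance.
have ? : b = b' by exact: Prop_irrelevance.
subst a' b'.
destruct a2, a3, a4, a5, a6, a7, b2, b3, b4, b5, b6, b7.
by f_equal; f_equal; exact: Prop_irrelevance.
Qed.

Definition borel (T : topologicalType) := g_sigma_algebraType (@open T).

Section wasserstein.
Context (R : realType) (T : pmetricType R) (p : R).

(* A library measure is a function on all subsets, constrained on measurable
   sets only. [Pp_nonborel] fixes its values elsewhere, so that two elements
   are equal iff they agree on the Borel sets ([Pp_ext]); it excludes no Borel
   measure ([borel_restr]). *)
Record Pp := {
  Pp_prob :> probability (borel T) R ;
  Pp_moment : exists x0 : T,
    (\int[Pp_prob]_(x in [set: T]) (mdist (x : T) x0 `^ p)%:E < +oo)%E ;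
  Pp_nonborel : forall A : set (borel T), ~ measurable A -> Pp_prob A = 0%E }.

Definition couplings (mu nu : probability (borel T) R) :
    set (probability (borel (T * T)%type) R) :=
  [set pi | (forall A : set (borel T), measurable A ->
               pi (fst @^-1` A) = mu A) /\
            (forall B : set (borel T), measurable B ->
               pi (snd @^-1` B) = nu B)].

Definition wasserstein_ereal (mu nu : probability (borel T) R) : \bar R :=
  (ereal_inf [set \int[pi]_(z in [set: T * T]) (mdist z.1 z.2 `^ p)%:E
             | pi in couplings mu nu] `^ p^-1)%E.

(* If [T] is proper and [1 <= p], the infimum is finite on [Pp] (the product
   measure is a coupling of finite cost), so [fine] loses nothing. *)
Definition wasserstein (mu nu : Pp) : R := fine (wasserstein_ereal mu nu).

Lemma Pp_ext (mu nu : Pp) :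
  (forall A : set (borel T), measurable A -> mu A = nu A) -> mu = nu.
Proof.
case: mu nu => [mu mumom mu0] [nu numom nu0] /= munu.
have e : mu = nu.
  apply: probability_eq; apply/funext => A.
  have [mA|nmA] := pselect (measurable A); first exact: munu.
  by rewrite mu0 // nu0.
subst nu.
by rewrite (Prop_irrelevance mumom numom) (Prop_irrelevance mu0 nu0).
Qed.

End wasserstein.

Section borel_restr.
Local Open Scope ereal_scope.
Context (R : realType) (T : pmetricType R) (P : probability (borel T) R).

Definition borel_cut (A : set (borel T)) : \bar R :=
  if pselect (measurable A) then P A else 0.

Let cutE (A : set (borel T)) : measurable A -> borel_cut A = P A.
Proof. by rewrite /borel_cut; case: pselect. Qed.

Let cut0 : borel_cut set0 = 0.
Proof. by rewrite cutE // measure0. Qed.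

Let cut_ge0 A : 0 <= borel_cut A.
Proof. by rewrite /borel_cut; case: pselect => [?|?] /=; rewrite ?measure_ge0. Qed.

Let cut_sigma_additive : semi_sigma_additive borel_cut.
Proof.
move=> F mF tF mUF; rewrite cutE //.
under eq_fun do under eq_bigr do rewrite cutE //.
exact: measure_semi_sigma_additive.
Qed.

HB.instance Definition _ := isMeasure.Build _ _ _ borel_cut cut0 cut_ge0 cut_sigma_additive.

Let cutT : borel_cut setT = 1.
Proof. by rewrite cutE // probability_setT. Qed.

HB.instance Definition _ := Measure_isProbability.Build _ _ _ borel_cut cutT.

Lemma borel_restr :
  exists2 P' : probability (borel T) R,
    forall A : set (borel T), measurable A -> P' A = P A &
    forall A : set (borel T), ~ measurable A -> P' A = 0.
Proof.
by exists borel_cut => [A mA|A nmA]; [exact: cutE|rewrite /= /borel_cut; case: pselect].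
Qed.

End borel_restr.

(* Main.v *)
Require Import Defs.
From HB Require Import structures.
From mathcomp Require Import all_boot all_order all_algebra.
From mathcomp Require Import complex.
From mathcomp Require Import all_classical all_reals all_analysis.
From mathcomp Require Import finmap measurable_realfun ring lra.
Set Implicit Arguments.
Unset Strict Implicit.
Unset Printing Implicit Defensive.
Import Order.TTheory GRing.Theory Num.Theory.
Import numFieldNormedType.Exports.
Local Open Scope classical_set_scope.
Local Open Scope ring_scope.

(** The maps [E n] need not be continuous, so it suffices to find maps
    [d n : X -> X] with finite range that converge to the identity uniformly on
    compact sets: [E n f] is then the number of the value [d n f] in a
    one-dimensional code, and [D n] is continuous because its domain is finite.

    For the Wasserstein space, cut [Omega] into finitely many cells: pieces of
    small diameter that cover the ball of radius [n + 1] around [x0], each with a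
    centre, and the complement, with centre [x0]. Round the masses of the cells
    down to multiples of [1 / m], put each rounded mass at the centre of its cell
    and the leftover mass at [x0]. Only finitely many measures arise in this way,
    and a coupling that moves each cell partly to its centre and partly
    to [x0] bounds its distance to [mu] by the mesh, the rounding error and the
    [p]-th moment of [mu] far from [x0].

    This far moment is uniformly small on compact sets: by Minkowski's inequality
    [mu |-> || (d(., x0) - k)_+ ||_{L^p(mu)}] is 1-Lipschitz for [W_p], and it
    decreases to [0] as [k] grows. Neither this nor the estimate above uses the
    triangle inequality for [W_p]; finiteness of [W_p], without which [fine] would
    be meaningless, comes from the product coupling. *)

(** * Encoders with finite range *)

Lemma finite_range_input_EDAP (R : realType) (K : numFieldType)
    (absK : K -> R) (X : Type) (rho : X -> X -> R) (d : nat -> X -> X) :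
  (forall x y, 0 <= rho x y) -> (forall n, finite_set (range (d n))) ->
  (forall A : set (dist_space rho), compact A -> forall e : R, 0 < e ->
     \forall n \near \oo, forall f, A f -> rho f (d n f) <= e) ->
  input_EDAP absK rho.
Proof.
move=> rho0 fd dA.
pose code_row (k : nat) : 'rV[K]_1 := const_mx k%:R.
have code_inj : injective code_row.
  by move=> i j /matrixP/(_ 0 0); rewrite !mxE => /eqP; rewrite eqr_nat => /eqP.
have /choice[c c_inj] n : exists c : X -> nat, {in range (d n) &, injective c}.
  by have /finite_set_countable/pcard_leP[f] := fd n; exists f.
pose E n f := code_row (c n (d n f)).
have E_inj n f g : E n f = E n g -> d n f = d n g.
  by move=> /code_inj/c_inj; apply; apply/mem_set; exact: imageT.
have fE n : finite_set (range (E n)).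
  rewrite (_ : range _ = (code_row \o c n) @` range (d n)); first exact: finite_image.
  by rewrite image_comp.
(* Finite sets are closed in a Hausdorff space. Applied to the whole range, this shows that the
   domain of [D n] consists of actual codes; applied to the range minus a point, it isolates that
   point. *)
have clE n (A : set 'rV[K]_1) : A `<=` range (E n) -> closed A.
  move=> AE.
  have /hausdorff_accessible/accessible_finite_set_closed :
    hausdorff_space 'rV[K]_1 by exact: norm_hausdorff.
  by apply; exact: sub_finite_set (fE n).
have codeP n (y : closure (range (E n))) : exists f, E n f = val y.
  have : closure (range (E n)) (val y) by apply: set_mem; exact: valP.
  move: (val y) => v; rewrite -((closure_id _).1 (clE n _ (@subset_refl _ _))).
  by move=> [f _ Ef]; exists f.
pose D n y := d n (sval (cid (codeP n y))).
exists (fun=> 1%N), E, D; split.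
(* Each norm is at most the sum over the finite range; adding [1] below makes the bound positive. *)
- pose r n := \sum_(v \in range (E n)) eucl_norm absK v.
  have r0 n v : range (E n) v -> eucl_norm absK v <= r n.
    move=> Ev; rewrite /r (fsbigD1 v)//= lerDl.
    by rewrite fsbig_finite ?sumr_ge0 // => [i _|]; [exact: sqrtr_ge0|exact: finite_setD].
  exists (fun n => 1 + r n).
    move=> n; rewrite ltr_pwDl// /r fsbig_finite// sumr_ge0 // => i _.
    exact: sqrtr_ge0.
  move=> A cA; exists 0%N => n _ f Af; rewrite ler_wpDl//; apply: r0.
  exact: imageT.
- move=> n y.
  (* [U] is open and meets the range of [E n] in [y] alone, so [y] is isolated in the domain of
     [D n]. *)
  pose U := ~` (range (E n) `\ val y).
  have oU : open U by apply: closed_openC; apply: clE; exact: subDsetl.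
  have Uy : nbhs y [set z | z = y].
    exists (val @^-1` U); split => //=.
    + by exists U.
    + by rewrite /U => -[_]; apply.
    + move=> z /= Uz; have [f Ef] := codeP n z.
      apply/val_inj; apply: contrapT => zy.
      by apply: Uz; split => //; exists f.
  by move=> V /= /nbhs_singleton VD; apply: filterS Uy => z -> /=.
- move=> A cA [f0 Af0].
  have DE n f : D n (Defs.code (E n) f) = d n f.
    by rewrite /D; case: cid => g /= /E_inj.
  have supP (e : R) : 0 < e -> \forall n \near \oo,
      (0 <= ereal_sup [set (rho f (D n (Defs.code (E n) f)))%:E | f in A] <= e%:E)%E.
    move=> e0; near=> n; apply/andP; split.
      apply: (@le_trans _ _ (rho f0 (D n (Defs.code (E n) f0)))%:E).
        by rewrite lee_fin.
      by apply: ereal_sup_ubound; exists f0.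
    apply: ge_ereal_sup => _ [f Af <-]; rewrite DE lee_fin; move: f Af.
    by near: n; exact: dA.
  apply/fine_cvgP; split.
    apply: filterS (supP 1 ltr01) => n /andP[s0 s1].
    by rewrite ge0_fin_numE// (le_lt_trans s1) ?ltry.
  apply/cvgr0Pnorm_le => e e0; apply: filterS (supP e e0) => n /andP[s0 s1].
  rewrite /= ger0_norm ?fine_ge0// -lee_fin fineK//.
  by rewrite ge0_fin_numE// (le_lt_trans s1) ?ltry.
Unshelve. all: by end_near.
Qed.

(** * Measures and integrals *)

Lemma measurable_fun_sigma_algebra d (X : measurableType d) (Y : pointedType)
    (G : set_system Y) (f : X -> Y) :
  (forall V, G V -> measurable (f @^-1` V)) ->
  measurable_fun [set: X] (f : X -> g_sigma_algebraType G).
Proof.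
move=> Gf; apply: (@measurability _ _ X (g_sigma_algebraType G) setT f G erefl).
by move=> _ [V GV <-]; rewrite setTI; exact: Gf.
Qed.

Lemma measurable_fun_open_preimage d (X : measurableType d) (R : realType)
    (f : X -> R) :
  (forall V : set R, open V -> measurable (f @^-1` V)) ->
  measurable_fun [set: X] f.
Proof.
move=> of_; apply: (measurability _ (RGenOInfty.measurableE R)).
by move=> _ [_ [x ->] <-]; rewrite setTI; apply: of_; exact: rray_open.
Qed.

Lemma continuous_mdist (R : realType) (T : metricType R) :
  continuous (fun z : T * T => mdist z.1 z.2).
Proof.
move=> [x y]; apply/cvgrPdist_lt => e e0.
have e2 : 0 < e / 2 by rewrite divr_gt0.
exists (ball x (e / 2), ball y (e / 2)) => /=.
  by split; exact: nbhsx_ballx.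
move=> [u v] /= []; rewrite !ballEmdist /= => xu yv.
rewrite [ltRHS]splitr.
apply: le_lt_trans (ltrD xu yv); rewrite ler_norml.
have := metric_triangle x u y; have := metric_triangle u v y.
have := metric_triangle u x v; have := metric_triangle x y v.
rewrite (metric_sym u x) (metric_sym v y); lra.
Qed.

Lemma continuous_mdistl (R : realType) (T : metricType R) (a : T) :
  continuous (fun x : T => mdist x a).
Proof.
move=> x; apply: (@continuous_comp T (T * T)%type R (fun x => (x, a))
  (fun z => mdist z.1 z.2)).
  by apply: cvg_pair => //; exact: cvg_cst.
exact: continuous_mdist.
Qed.

Lemma probability_map d d' (X : measurableType d) (Y : measurableType d')
    (R : realType) (P : probability X R) (f : X -> Y) :
  measurable_fun [set: X] f ->
  exists2 Q : probability Y R, forall A, Q A = P (f @^-1` A) &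
    forall (D : set Y) (g : Y -> \bar R), measurable D ->
      measurable_fun [set: Y] g -> (forall y, 0 <= g y)%E ->
      (\int[Q]_(y in D) g y = \int[P]_(x in f @^-1` D) g (f x))%E.
Proof.
move=> mf.
pose F : {mfun X >-> Y} := HB.pack f (isMeasurableFun.Build _ _ _ _ _ mf).
exists (distribution P F) => // D g mD mg g0.
by rewrite (ge0_integral_pushforward mf)//; exact: measurable_funTS.
Qed.

Lemma ge0_integral_mrestr d (X : measurableType d) (R : realType)
    (m : {measure set X -> \bar R}) (B : set X) (mB : measurable B)
    (g : X -> \bar R) :
  measurable_fun [set: X] g -> (forall x, 0 <= g x)%E ->
  (\int[mrestr m mB]_x g x = \int[m]_(x in B) g x)%E.
Proof.
move=> mg g0; rewrite -(setUv B) ge0_integral_setU //; last first.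
- by rewrite disj_set2E setICr.
- by rewrite setUv.
- exact: measurableC.
(* Off [B] the restricted measure coincides with the zero measure. *)
rewrite [X in (_ + X)%E](_ : _ = 0%E) ?adde0; last first.
  have -> : (\int[mrestr m mB]_(x in ~` B) g x = \int[mzero]_(x in ~` B) g x)%E.
    apply: eq_measure_integral => A mA AB; rewrite /mzero /= /mrestr.
    by move/disjoints_subset: AB => ->; rewrite measure0.
  by rewrite integral_measure_zero.
by apply: eq_measure_integral => A mA AB; rewrite /= /mrestr setIidl.
Qed.

(** Each [Q i] is restricted to its own [B i] before scaling, so that different cells can be
    transported by different laws. *)
Lemma mixture_measure d (X : measurableType d) (R : realType)
    (Q : nat -> {measure set X -> \bar R}) (B : nat -> set X) (c : nat -> R)
    (n : nat) :
  (forall i, measurable (B i)) -> (forall i, 0 <= c i) ->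
  exists m : {measure set X -> \bar R},
    forall g : X -> \bar R, measurable_fun [set: X] g -> (forall x, 0 <= g x)%E ->
    (\int[m]_x g x = \sum_(i < n) (c i)%:E * \int[Q i]_(x in B i) g x)%E.
Proof.
move=> mB c0.
pose m_ i : {measure set X -> \bar R} := mscale (NngNum (c0 i)) (mrestr (Q i) (mB i)).
exists (msum m_ n) => g mg g0.
rewrite ge0_integral_measure_sum//; apply: eq_bigr => i _.
by rewrite ge0_integral_mscale//= ge0_integral_mrestr.
Qed.

Lemma measurable_fun_powR d (X : measurableType d) (R : realType) (p : R)
    (f : X -> R) :
  measurable_fun [set: X] f -> measurable_fun [set: X] (fun x => f x `^ p).
Proof. exact: (measurableT_comp (measurable_powR p)). Qed.

(** Normalizing a measure of mass [1] changes nothing; [P0] is the fallback of [mnormalize] for the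
    masses [0] and [+oo]. *)
Lemma probability_of_measure d (X : measurableType d) (R : realType)
    (P0 : probability X R) (m : {measure set X -> \bar R}) :
  m setT = 1%E -> exists P : probability X R, (P : set X -> \bar R) = m.
Proof.
move=> m1; exists (mnormalize m P0); apply/funext => A.
by rewrite /= /mnormalize m1 onee_eq0 /= invr1 mule1.
Qed.

(** * Borel sets and couplings in proper spaces *)

Lemma proper_finite_net (R : realType) (T : pmetricType R) (x0 : T) (r e : R) :
  proper_metric T -> 0 < r -> 0 < e ->
  exists s : seq T, forall x, mdist x x0 <= r ->
    exists2 i, (i < size s)%N & mdist x (nth x0 s i) < e.
Proof.
move=> pT r0 e0; have := pT x0 r r0; rewrite compact_cover.
move=> /(_ T setT (fun y => [set x | mdist x y < e])) [].
- move=> y _; apply: open_comp (@open_lt R e) => x _; exact: continuous_mdistl.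
- by move=> x _; exists x => //=; rewrite mdistxx.
- move=> D _ cD; exists (enum_fset D) => x /cD[y /= yD xy].
  by exists (index y (enum_fset D)); rewrite ?index_mem ?nth_index.
Qed.

Lemma measurable_continuous1 (R : realType) (T : pmetricType R) (f : T -> R) :
  continuous f -> measurable_fun [set: borel T] (f : borel T -> R).
Proof.
move=> /continuousP cf; apply: measurable_fun_open_preimage => V oV.
by apply: sub_sigma_algebra; exact: cf.
Qed.

Lemma measurable_continuous2 (R : realType) (T : pmetricType R)
    (f : T * T -> R) :
  continuous f ->
  measurable_fun [set: borel (T * T)%type] (f : borel (T * T)%type -> R).
Proof.
move=> /continuousP cf; apply: measurable_fun_open_preimage => V oV.
by apply: sub_sigma_algebra; exact: cf.
Qed.

Lemma measurable_mball (R : realType) (T : pmetricType R) (y : T) (e : R) :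
  measurable ([set x | mdist x y < e] : set (borel T)).
Proof.
apply: sub_sigma_algebra; apply: open_comp (@open_lt R e) => x _.
exact: continuous_mdistl.
Qed.

(** Product measures live on the product of the Borel sigma-algebras, couplings on the Borel sets of
    the product. The former sigma-algebra contains the latter because a proper space is separable:
    every open set of [T * T] is a countable union of products of balls. *)
Lemma measurable_borel_prod (R : realType) (T : pmetricType R) :
  proper_metric T ->
  measurable_fun [set: (borel T * borel T)%type]
    (id : borel T * borel T -> borel (T * T)%type).
Proof.
move=> pT.
apply: measurable_fun_sigma_algebra => U oU; rewrite preimage_id.
pose x0 : T := point.
have /choice[s sP] n : exists s : seq T, forall x, mdist x x0 <= n.+1%:R ->
    exists2 i, (i < size s)%N & mdist x (nth x0 s i) < n.+1%:R^-1.
  (* The [n]-th net has mesh [1 / (n + 1)] on the ball of radius [n + 1], so together the finite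
     nets form a countable dense set. *)
  by apply: proper_finite_net.
pose B n i := [set x : T | mdist x (nth x0 (s n) i) < n.+1%:R^-1].
(* Products of balls that leave [U] are replaced by the empty set, so the union may run over all
   indices. *)
pose C n i j := if pselect (B n i `*` B n j `<=` U) then B n i `*` B n j else set0.
suff -> : U = \bigcup_n \bigcup_i \bigcup_j (C n i j).
  apply: bigcupT_measurable => n; apply: bigcupT_measurable => i.
  apply: bigcupT_measurable => j; rewrite /C; case: pselect => /= _ //.
  by apply: measurableX; exact: measurable_mball.
apply/seteqP; split=> [[x y] Uxy|z [n _ [i _ [j _]]]]; last first.
  by rewrite /C; case: pselect => //= + Cz; apply.
have /nbhs_ballP[e /= e0 eU] : nbhs (x, y) U by exact: open_nbhs_nbhs.
have [n [ne nx ny]] : exists n : nat,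
    [/\ 2 * n.+1%:R^-1 < e, mdist x x0 <= n.+1%:R & mdist y x0 <= n.+1%:R].
  (* The sum exceeds each requirement separately. The factor [2] in [2 / (n + 1) < e] accounts for
     passing from a point to another one of the same ball through the centre. *)
  exists (Num.truncn (2 / e) + Num.truncn (mdist x x0) + Num.truncn (mdist y x0))%N.
  rewrite -!natr1 !natrD.
  have := truncnS_gt (2 / e); have := truncnS_gt (mdist x x0).
  have := truncnS_gt (mdist y x0); rewrite -!natr1.
  move: (Num.truncn _) (Num.truncn _) (Num.truncn _) => a b c ha hb hc.
  have := ler0n R a; have := ler0n R b; have := ler0n R c => c0 b0 a0.
  split; [|lra..].
  rewrite ltr_pdivrMr; last lra.
  rewrite mulrC -ltr_pdivrMr//; lra.
have [i _ xi] := sP n x nx; have [j _ yj] := sP n y ny.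
exists n => //; exists i => //; exists j => //.
rewrite /C; case: pselect => [_|BU] /=; first by split.
exfalso; apply: BU => -[u v] [/= ui vj].
apply: eU; split; rewrite ballEmdist /=.
  apply: le_lt_trans (metric_triangle x (nth x0 (s n) i) u) _.
  rewrite (metric_sym _ u); apply: lt_trans ne.
  by rewrite mulr_natl mulr2n ltrD.
apply: le_lt_trans (metric_triangle y (nth x0 (s n) j) v) _.
rewrite (metric_sym _ v); apply: lt_trans ne.
by rewrite mulr_natl mulr2n ltrD.
Qed.

(** The sum is at most twice the larger term. The constant is crude, but only finiteness of
    integrals is drawn from it. *)
Lemma powR_addr_le (R : realType) (p a b : R) : 0 <= p -> 0 <= a -> 0 <= b ->
  (a + b) `^ p <= 2 `^ p * (a `^ p + b `^ p).
Proof.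
move=> p0 a0 b0; wlog ab : a b a0 b0 / a <= b.
  move=> H; case: (leP a b) => [|/ltW] ab; first exact: H.
  by rewrite addrC (addrC (a `^ p)); exact: H.
apply: (@le_trans _ _ ((2 * b) `^ p)).
  by apply: ge0_ler_powR; rewrite ?nnegrE ?addr_ge0 ?mulr_ge0 //; lra.
by rewrite powRM// ler_wpM2l ?powR_ge0// lerDr powR_ge0.
Qed.

Section coupling.
Context (R : realType) (T : pmetricType R) (p : R) (p1 : 1 <= p).
Local Open Scope ereal_scope.
Implicit Types (mu nu : probability (borel T) R).

Lemma measurable_mdist_powR (x0 : T) :
  measurable_fun [set: borel T] (fun x : borel T => (mdist (x : T) x0 `^ p)%:E).
Proof.
apply/measurable_EFinP; apply: measurable_fun_powR.
apply: measurable_continuous1; exact: continuous_mdistl.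
Qed.

Lemma measurable_cost :
  measurable_fun [set: borel (T * T)%type]
    (fun z : borel (T * T)%type => (mdist (z : T * T).1 (z : T * T).2 `^ p)%:E).
Proof.
apply/measurable_EFinP; apply: measurable_fun_powR.
apply: measurable_continuous2; exact: continuous_mdist.
Qed.

Lemma measurable_borel_fst :
  measurable_fun [set: borel (T * T)%type] (fst : borel (T * T)%type -> borel T).
Proof. 
apply: measurable_fun_sigma_algebra => V oV; apply: sub_sigma_algebra.
by apply: open_comp => // -[x y] _; exact: cvg_fst.
 Qed.

Lemma measurable_borel_snd :
  measurable_fun [set: borel (T * T)%type] (snd : borel (T * T)%type -> borel T).
Proof. 
apply: measurable_fun_sigma_algebra => V oV; apply: sub_sigma_algebra.
by apply: open_comp => // -[x y] _; exact: cvg_snd.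
 Qed.

Lemma integral_coupling_fst mu nu pi (g : borel T -> \bar R) :
  couplings mu nu pi -> measurable_fun [set: borel T] g -> (forall x, 0 <= g x) ->
  \int[pi]_z g (z : T * T).1 = \int[mu]_x g x.
Proof.
move=> [pi1 _] mg g0.
have [Q QE Qint] := probability_map pi measurable_borel_fst.
rewrite -[LHS](Qint setT g)//; apply: eq_measure_integral => A mA _.
exact: (etrans (QE A) (pi1 A mA)).
Qed.

Lemma integral_coupling_snd mu nu pi (g : borel T -> \bar R) :
  couplings mu nu pi -> measurable_fun [set: borel T] g -> (forall x, 0 <= g x) ->
  \int[pi]_z g (z : T * T).2 = \int[nu]_x g x.
Proof.
move=> [_ pi2] mg g0.
have [Q QE Qint] := probability_map pi measurable_borel_snd.
rewrite -[LHS](Qint setT g)//; apply: eq_measure_integral => A mA _.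
exact: (etrans (QE A) (pi2 A mA)).
Qed.

(** The product measure is carried over to the Borel sets of [T * T] by [measurable_borel_prod],
    which is where properness enters. *)
Lemma product_coupling mu nu : proper_metric T ->
  couplings mu nu !=set0.
Proof.
move=> pT.
have [Q QE _] := probability_map (mu \x nu : probability _ R) (measurable_borel_prod pT).
exists Q; split=> A mA; apply: (etrans (QE _)); rewrite preimage_id.
  have -> : fst @^-1` A = A `*` [set: borel T] 
    by apply/seteqP; split=> [[x y] ?|[x y] []].
  by rewrite [LHS]product_measure1E// [X in _ * X]probability_setT mule1.
have -> : snd @^-1` A = [set: borel T] `*` A 
    by apply/seteqP; split=> [[x y] ?|[x y] []].
by rewrite [LHS]product_measure1E// [X in X * _]probability_setT mul1e.
Qed.

(** Turns a pointwise triangle inequality into finiteness of a [p]-th moment: used to change the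
    base point, to bound the cost of a coupling, and to see that a quantized measure has a
    moment. *)
Lemma ge0_le_integral_powR2 d (X : measurableType d) (P : {measure set X -> \bar R})
    (f g h : X -> R) :
  measurable_fun [set: X] f -> measurable_fun [set: X] g ->
  measurable_fun [set: X] h ->
  (forall x, (0 <= f x)%R) -> (forall x, (0 <= g x)%R) -> (forall x, (0 <= h x)%R) ->
  (forall x, (f x <= g x + h x)%R) ->
  \int[P]_x (g x `^ p)%:E < +oo -> \int[P]_x (h x `^ p)%:E < +oo ->
  \int[P]_x (f x `^ p)%:E < +oo.
Proof.
move=> mf mg mh f0 g0 h0 fgh gy hy.
have mp u : measurable_fun [set: X] u ->
    measurable_fun [set: X] (fun x => (u x `^ p)%:E).
  by move=> mu; apply/measurable_EFinP; exact: measurable_fun_powR.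
have p0 : (0 <= p)%R by apply: le_trans p1.
apply: (@le_lt_trans _ _ (\int[P]_x ((2 `^ p)%:E * ((g x `^ p)%:E + (h x `^ p)%:E)))).
  apply: ge0_le_integral => //.
  - by move=> x _; rewrite lee_fin powR_ge0.
  - exact: mp.
  - by apply: measurable_funeM; apply: emeasurable_funD; exact: mp.
  - move=> x _; rewrite -EFinD -EFinM lee_fin.
    apply: le_trans (powR_addr_le p0 (g0 x) (h0 x)).
    by apply: ge0_ler_powR => //; rewrite ?nnegrE ?addr_ge0.
rewrite ge0_integralZl_EFin ?powR_ge0//; last 2 first.
- by move=> x _; rewrite -EFinD lee_fin addr_ge0 ?powR_ge0.
- by apply: emeasurable_funD; exact: mp.
rewrite ge0_integralD//; first last.
- exact: mp.
- by move=> x _; rewrite lee_fin powR_ge0.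
- exact: mp.
- by move=> x _; rewrite lee_fin powR_ge0.
by rewrite lte_mul_pinfty ?lee_fin ?powR_ge0// lte_add_pinfty.
Qed.

Lemma Pp_moment_point (mu : Pp T p) (x0 : T) :
  \int[mu]_x (mdist (x : T) x0 `^ p)%:E < +oo.
Proof.
have [x1 h] := Pp_moment mu.
apply: (@ge0_le_integral_powR2 _ _ mu _ (fun x => mdist (x : T) x1)
  (fun=> mdist x1 x0)) => //; try by move=> x; exact: mdist_ge0.
- by apply: measurable_continuous1; exact: continuous_mdistl.
- by apply: measurable_continuous1; exact: continuous_mdistl.
- by move=> x; exact: metric_triangle.
- by rewrite integral_cst// [X in _ * X]probability_setT mule1 ltry.
Qed.

Lemma cost_lty mu nu pi (x0 : T) : couplings mu nu pi ->
  \int[mu]_x (mdist (x : T) x0 `^ p)%:E < +oo ->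
  \int[nu]_x (mdist (x : T) x0 `^ p)%:E < +oo ->
  \int[pi]_z (mdist (z : T * T).1 (z : T * T).2 `^ p)%:E < +oo.
Proof.
move=> cpi muy nuy.
apply: (@ge0_le_integral_powR2 _ _ pi _ (fun z => mdist (z : T * T).1 x0)
  (fun z => mdist (z : T * T).2 x0)) => //; try by move=> x; exact: mdist_ge0.
- apply: measurable_continuous2; exact: continuous_mdist.
- apply: (measurableT_comp (f := fun x : borel T => mdist (x : T) x0) _
    measurable_borel_fst).
  by apply: measurable_continuous1; exact: continuous_mdistl.
- apply: (measurableT_comp (f := fun x : borel T => mdist (x : T) x0) _
    measurable_borel_snd).
  by apply: measurable_continuous1; exact: continuous_mdistl.
- by move=> x; rewrite (metric_sym x.2); exact: metric_triangle.
- rewrite (integral_coupling_fst (g := fun x => (mdist (x : T) x0 `^ p)%:E) cpi)//.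
    exact: measurable_mdist_powR.
  by move=> x; rewrite lee_fin powR_ge0.
- rewrite (integral_coupling_snd (g := fun x => (mdist (x : T) x0 `^ p)%:E) cpi)//.
    exact: measurable_mdist_powR.
  by move=> x; rewrite lee_fin powR_ge0.
Qed.

End coupling.

(** * Uniform tails on compact sets *)

Section wasserstein_estimates.
Context (R : realType) (T : pmetricType R) (p : R) (p1 : 1 <= p).
Local Open Scope ereal_scope.
Implicit Types (mu nu : Pp T p).

Let p0 : (0 < p)%R. Proof. exact: lt_le_trans p1. Qed.

Let cost (pi : probability (borel (T * T)%type) R) :=
  \int[pi]_(z in [set: T * T]) (mdist z.1 z.2 `^ p)%:E.

Let cost_ge0 pi : 0 <= cost pi.
Proof. by apply: integral_ge0 => z _; rewrite lee_fin powR_ge0. Qed.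

Let inf_cost_ge0 mu nu : 0 <= ereal_inf [set cost pi | pi in couplings mu nu].
Proof. by apply: le_ereal_inf_tmp => _ [pi _ <-]; exact: cost_ge0. Qed.

Lemma powRVK (x : R) : (0 <= x)%R -> ((x `^ p) `^ p^-1)%R = x.
Proof. by move=> x0; rewrite -powRrM divff ?powRr1// gt_eqF. Qed.

Lemma poweRV_le (x y : \bar R) : 0 <= x -> x <= y -> x `^ p^-1 <= y `^ p^-1.
Proof.
move=> x0 xy; apply: gt0_ler_poweR => //; first by rewrite invr_ge0 ltW.
- by rewrite in_itv /= x0 leey.
- by rewrite in_itv /= (le_trans x0 xy) leey.
Qed.

(** Lets strict bounds pass between costs, which are integrals of [p]-th powers, and their [p]-th
    roots. *)
Lemma poweRV_ltP (x : \bar R) (e : R) : 0 <= x -> (0 <= e)%R ->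
  (x < (e `^ p)%:E) = (x `^ p^-1 < e%:E).
Proof.
move=> x0 e0; apply/idP/idP => [|h]; last first.
  rewrite ltNge; apply/negP => ex; move: h; apply/negP; rewrite -leNgt.
  by rewrite -{1}(powRVK e0) -poweR_EFin poweRV_le// lee_fin powR_ge0.
case: x x0 => [x| |]//; rewrite lee_fin => x0; rewrite lte_fin => xe.
rewrite poweR_EFin lte_fin -[ltRHS](powRVK e0).
apply: gt0_ltr_powR => //; rewrite ?invr_gt0 ?nnegrE//; exact: powR_ge0.
Qed.

Lemma wasserstein_ge0 mu nu : (0 <= wasserstein mu nu)%R.
Proof. by rewrite fine_ge0// poweR_ge0. Qed.

Lemma wasserstein_le mu nu pi (c : R) : (0 <= c)%R -> couplings mu nu pi ->
  \int[pi]_(z in [set: T * T]) (mdist z.1 z.2 `^ p)%:E <= (c `^ p)%:E ->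
  (wasserstein mu nu <= c)%R.
Proof.
move=> c0 cpi pic.
have : wasserstein_ereal p mu nu <= c%:E.
  rewrite -(powRVK c0) -poweR_EFin; apply: poweRV_le; first exact: inf_cost_ge0.
  by apply: le_trans pic; apply: ereal_inf_lbound; exists pi.
rewrite /wasserstein.
have : 0 <= wasserstein_ereal p mu nu by exact: poweR_ge0.
(* The value [+oo] contradicts the bound by [c]; at [-oo], [fine] returns [0]. *)
case: wasserstein_ereal => [r _|_|_ _].
- by rewrite lee_fin.
- by rewrite leye_eq.
- exact: c0.
Qed.

Lemma wasserstein_lt mu nu (e : R) : proper_metric T ->
  (wasserstein mu nu < e)%R ->
  exists2 pi, couplings mu nu pi &
    (\int[pi]_(z in [set: T * T]) (mdist z.1 z.2 `^ p)%:E) `^ p^-1 < e%:E.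
Proof.
move=> pT We.
have e0 : (0 < e)%R by apply: le_lt_trans We; exact: wasserstein_ge0.
have [pi0 cpi0] := product_coupling mu nu pT.
(* Since [fine] sends [+oo] to [0], the hypothesis [We] is informative only once the infimum is
   known to be finite. *)
have infoo : ereal_inf [set cost pi | pi in couplings mu nu] < +oo.
  apply: le_lt_trans (cost_lty p1 cpi0 (Pp_moment_point p1 mu point)
    (Pp_moment_point p1 nu point)).
  by apply: ereal_inf_lbound; exists pi0.
have : ereal_inf [set cost pi | pi in couplings mu nu] < (e `^ p)%:E.
  rewrite poweRV_ltP// ?(ltW e0)//; move: We; rewrite /wasserstein /wasserstein_ereal.
  rewrite -lte_fin fineK// ge0_fin_numE ?poweR_ge0//; exact: poweR_lty.
move=> /ereal_inf_lt[_ [pi cpi <-] pie].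
exists pi => //; rewrite -poweRV_ltP ?(ltW e0)//; exact: cost_ge0.
Qed.

(** A positive part is preferred to cutting the distance off outside a ball because it is
    1-Lipschitz in [x]. *)
Definition excess (x0 : T) (k : nat) (x : T) : R :=
  Num.max (mdist x x0 - k%:R)%R 0%R.

Definition tail (x0 : T) (k : nat) (mu : probability (borel T) R) : \bar R :=
  (\int[mu]_x (excess x0 k (x : T) `^ p)%:E) `^ p^-1.

Lemma excess_ge0 x0 k x : (0 <= excess x0 k x)%R.
Proof. by rewrite /excess le_max lexx orbT. Qed.

Lemma measurable_excess x0 k :
  measurable_fun [set: borel T] (excess x0 k : borel T -> R).
Proof.
apply: measurable_maxr; last exact: measurable_cst.
apply: measurable_funB; last exact: measurable_cst.
apply: measurable_continuous1; exact: continuous_mdistl.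
Qed.

Lemma excess_lipschitz x0 k x y :
  (excess x0 k y <= excess x0 k x + mdist x y)%R.
Proof.
rewrite /excess ge_max addr_ge0 ?mdist_ge0 ?le_max ?lexx ?orbT// andbT.
apply: (@le_trans _ _ (mdist x x0 - k%:R + mdist x y)%R); last first.
  by rewrite lerD2r le_max lexx.
by have := metric_triangle y x x0; rewrite (metric_sym y x); lra.
Qed.

Lemma Lnorm_ge0fun d (X : measurableType d) (P : {measure set X -> \bar R})
    (f : X -> R) : (forall x, (0 <= f x)%R) ->
  Lnorm P p%:E (EFin \o f) = (\int[P]_x (f x `^ p)%:E) `^ p^-1.
Proof.
move=> f0; rewrite unlock; congr (_ `^ _); apply: eq_integral => x _ /=.
by rewrite ger0_norm ?f0.
Qed.

(** Both tails become norms in [L^p(pi)] through the marginals; then [excess_lipschitz] and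
    Minkowski's inequality apply. Any coupling is allowed, so a nearly optimal one can be
    inserted. *)
Lemma tail_lipschitz x0 k mu nu pi : couplings mu nu pi ->
  tail x0 k nu <=
  tail x0 k mu + (\int[pi]_(z in [set: T * T]) (mdist z.1 z.2 `^ p)%:E) `^ p^-1.
Proof.
move=> cpi.
have mk : measurable_fun [set: borel T]
    (fun x : borel T => (excess x0 k (x : T) `^ p)%:E).
  by apply/measurable_EFinP; apply: measurable_fun_powR; exact: measurable_excess.
have k0 (x : borel T) : 0 <= (excess x0 k (x : T) `^ p)%:E.
  by rewrite lee_fin powR_ge0.
rewrite /tail -(integral_coupling_fst cpi mk k0) -(integral_coupling_snd cpi mk k0).
pose f (z : borel (T * T)%type) := excess x0 k (z : T * T).1.
pose g (z : borel (T * T)%type) := mdist (z : T * T).1 (z : T * T).2.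
have mf : measurable_fun [set: borel (T * T)%type] f.
  exact: (measurableT_comp (measurable_excess x0 k) (@measurable_borel_fst R T)).
have mg : measurable_fun [set: borel (T * T)%type] g.
  apply: measurable_continuous2; exact: continuous_mdist.
have f0 z : (0 <= f z)%R by exact: excess_ge0.
have g0 z : (0 <= g z)%R by exact: mdist_ge0.
rewrite -[X in _ <= X + _](Lnorm_ge0fun pi f0) -[X in _ <= _ + X](Lnorm_ge0fun pi g0).
apply: le_trans (minkowski_EFin pi mf mg p1).
rewrite Lnorm_ge0fun; last by move=> z; rewrite /= addr_ge0.
apply: poweRV_le; first by apply: integral_ge0 => z _; rewrite lee_fin powR_ge0.
apply: ge0_le_integral => //.
- apply/measurable_EFinP; apply: measurable_fun_powR.
  exact: (measurableT_comp (measurable_excess x0 k) (@measurable_borel_snd R T)).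
- apply/measurable_EFinP; apply: measurable_fun_powR; exact: measurable_funD.
- move=> z _; rewrite lee_fin; apply: ge0_ler_powR; rewrite ?nnegrE.
  + exact: ltW.
  + exact: excess_ge0.
  + by rewrite /= addr_ge0.
  + exact: excess_lipschitz.
Qed.

Lemma le_tail x0 k k' mu : (k <= k')%N -> tail x0 k' mu <= tail x0 k mu.
Proof.
move=> kk'; apply: poweRV_le; first by apply: integral_ge0 => z _; rewrite lee_fin powR_ge0.
apply: ge0_le_integral => //.
- by move=> z _; rewrite lee_fin powR_ge0.
- by apply/measurable_EFinP; apply: measurable_fun_powR; exact: measurable_excess.
- by apply/measurable_EFinP; apply: measurable_fun_powR; exact: measurable_excess.
- move=> x _; rewrite lee_fin; apply: ge0_ler_powR; rewrite ?nnegrE ?excess_ge0 ?(ltW p0)//.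
  by rewrite /excess ge_max !le_max lexx orbT andbT lerB ?ler_nat.
Qed.

Lemma tail_small x0 mu (e : R) : (0 < e)%R -> exists k, tail x0 k mu < e%:E.
Proof.
move=> e0.
have mk k : measurable_fun [set: borel T]
    (fun x : borel T => (excess x0 k (x : T) `^ p)%:E).
  by apply/measurable_EFinP; apply: measurable_fun_powR; exact: measurable_excess.
have [] := @dominated_convergence _ _ _ mu setT measurableT
  (fun k x => (excess x0 k (x : T) `^ p)%:E) (cst 0)
  (fun x => (mdist (x : T) x0 `^ p)%:E) => //.
- apply: aeW => x _.
  have [k0 xk0] : exists k0 : nat, (mdist (x : T) x0 <= k0%:R)%R.
    by exists (Num.truncn (mdist (x : T) x0)).+1; exact/ltW/truncnS_gt.
  apply: cvg_near_cst; exists k0 => // k /= k0k.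
  rewrite /excess (_ : Num.max _ _ = 0)%R ?powR0 ?gt_eqF//.
  by apply/max_idPr; rewrite subr_le0 (le_trans xk0)// ler_nat.
- apply/integrableP; split; first exact: measurable_mdist_powR.
  under eq_integral do rewrite gee0_abs ?lee_fin ?powR_ge0//.
  exact: Pp_moment_point.
- apply: aeW => x k _; rewrite gee0_abs ?lee_fin ?powR_ge0//.
  apply: ge0_ler_powR; rewrite ?nnegrE ?excess_ge0 ?mdist_ge0 ?(ltW p0)//.
  by rewrite /excess ge_max mdist_ge0 andbT gerBl ler0n.
move=> _ _; rewrite integral0 => /fine_cvgP[kfin /cvgr0Pnorm_lt kcvg].
have ep0 : (0 < e `^ p)%R by exact: powR_gt0.
near \oo => k; exists k; rewrite /tail -poweRV_ltP ?(ltW e0)//; last first.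
  by apply: integral_ge0 => z _; rewrite lee_fin powR_ge0.
rewrite -[ltLHS]fineK; last by near: k.
by rewrite lte_fin; apply: le_lt_trans (ler_norm _) _; near: k; exact: kcvg.
Unshelve. all: by end_near. Qed.

(** Sublevel sets of the tail at a fixed index are open by [tail_lipschitz], and monotonicity in [k]
    extends the bound to all later indices. The joint neighbourhood is what the near-covering form
    of compactness asks for. *)
Lemma near_tail x0 mu (e : R) : proper_metric T -> (0 < e)%R ->
  \forall nu \near (mu : dist_space (@wasserstein R T p)) & k \near \oo,
    tail x0 k (nu : Pp T p) < e%:E.
Proof.
move=> pT e0; have [k0 tk0] := tail_small x0 mu e0.
pose U : set (dist_space (@wasserstein R T p)) :=
  [set nu : Pp T p | tail x0 k0 nu < e%:E].
have oU : dist_open (@wasserstein R T p) U.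
  move=> nu tnu.
  have tfin : tail x0 k0 nu \is a fin_num.
    by rewrite ge0_fin_numE ?poweR_ge0// (lt_trans tnu) ?ltry.
  exists (e - fine (tail x0 k0 nu))%R.
    by rewrite subr_gt0 -lte_fin fineK.
  move=> nu' /= /(wasserstein_lt pT)[pi cpi pie].
  apply: (le_lt_trans (tail_lipschitz x0 k0 cpi)).
  by rewrite -(fineK tfin) -lteBrDl.
exists (U, [set k | (k0 <= k)%N]) => /=.
  split; last by exists k0.
  exact: (@open_nbhs_nbhs (dist_space (@wasserstein R T p)) _ U (conj oU tk0)).
move=> [nu k] /= [tnu k0k]; exact: le_lt_trans (le_tail x0 nu k0k) tnu.
Qed.

(** Dini's argument: the tails decrease to [0] pointwise and have open sublevel sets, hence become
    small uniformly on a compact set. *)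
Lemma compact_tail x0 (A : set (dist_space (@wasserstein R T p))) (e : R) :
  proper_metric T -> compact A -> (0 < e)%R ->
  exists k, forall mu : Pp T p, A mu -> tail x0 k mu < e%:E.
Proof.
move=> pT /compact_near_coveringP cA e0.
have [] := cA nat \oo (fun k (mu : Pp T p) => tail x0 k mu < e%:E) _.
  by move=> mu _; exact: near_tail.
by move=> k _ kA; exists k; apply: kA => /=.
Qed.

End wasserstein_estimates.

(** * Finite quantization *)

Lemma finite_range_factor (X Y : Type) (J : finType) (q : X -> J) (d : X -> Y) :
  (forall x x', q x = q x' -> d x = d x') -> finite_set (range d).
Proof.
move=> qd; have [->//|/set0P[_ [x0 _ _]]] := eqVneq (range d) set0.
(* Values that [q] does not take are sent to [d x0], which is why an empty range was treated
   first. *)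
pose h j := if pselect (exists x, q x = j) is left ex then d (sval (cid ex)) else d x0.
apply: (@sub_finite_set _ _ (range h)); last exact: finite_image.
move=> _ [x _ <-]; exists (q x) => //; rewrite /h; case: pselect => [ex|].
  by apply: qd; case: cid.
by case; exists x.
Qed.

Lemma proper_partition (R : realType) (T : pmetricType R) (x0 : T) (r e : R) :
  proper_metric T -> 0 < r -> 0 < e ->
  exists k (A : nat -> set (borel T)) (y : nat -> T),
  [/\ forall i, measurable (A i), trivIset setT A,
      \big[setU/set0]_(i < k) A i = setT &
      forall i x, (i < k)%N -> A i x ->
        mdist x (y i) < e \/ y i = x0 /\ r < mdist x x0].
Proof.
move=> pT r0 e0; have [s sP] := proper_finite_net x0 pT r0 e0.
(* From index [size s] on the sets are the whole space, so after disjointification the cell [size s]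
   is what the balls leave over. Its centre is the default [x0] of [nth]. *)
pose F i : set (borel T) :=
  if (i < size s)%N then [set x : T | mdist x (nth x0 s i) < e] else setT.
have mF i : measurable (F i).
  by rewrite /F; case: ifPn => // _; exact: measurable_mball.
exists (size s).+1, (seqDU F), (nth x0 s); split.
- exact: seqDU_measurable.
- exact: trivIset_seqDU.
- rewrite -bigsetU_seqDU big_ord_recr /= /F ltnn; exact: setUT.
- move=> i x; rewrite ltnS leq_eqVlt => /orP[/eqP -> [_ nF]|si Aix].
    right; split; first by rewrite nth_default.
    rewrite ltNge; apply/negP => dr; have [j js xj] := sP x dr; apply: nF.
    by rewrite -bigcup_mkord; exists j => //=; rewrite /F js.
  by have := subset_seqDU Aix; rewrite /F si; left.
Qed.

Section mixture_coupling.
Context (R : realType) (T : pmetricType R) (mu : probability (borel T) R).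
Context (k : nat) (A : nat -> set (borel T)) (a : nat -> R) (y : nat -> T) (x0 : T).
Context (mA : forall i, measurable (A i)) (tA : trivIset setT A).
Context (cA : \big[setU/set0]_(i < k) A i = setT).
Context (a01 : forall i, 0 <= a i <= 1).
Local Open Scope ereal_scope.

Lemma measurable_pairl (v : T) :
  measurable_fun [set: borel T] (fun x => (x : T, v) : borel (T * T)%type).
Proof.
apply: measurable_fun_sigma_algebra => V oV; apply: sub_sigma_algebra.
apply: (@open_comp T (T * T)%type (fun x => (x, v))) => // x _.
by apply: cvg_pair => //; exact: cvg_cst.
Qed.

Lemma ge0_integral_partition (g : borel T -> \bar R) :
  measurable_fun [set: borel T] g -> (forall x, 0 <= g x) ->
  \int[mu]_x g x = \sum_(i < k) \int[mu]_(x in A i) g x.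
Proof.
move=> mg g0.
have := @ge0_integral_bigsetU _ _ _ mu _ A g (index_iota 0 k) mA (iota_uniq _ _).
rewrite /= !big_mkord cA; apply => // ; exact: sub_trivIset tA.
Qed.

(** A share [a i] of the cell [A i] moves to [y i] and the rest to [x0]. The integral formula serves
    the cost estimate; the second marginal is written out as a sum of point masses so that its
    dependence on [mu] can be read off. *)
Lemma mixture_coupling :
  exists pi : probability (borel (T * T)%type) R,
    [/\ forall g : borel (T * T)%type -> \bar R,
          measurable_fun [set: borel (T * T)%type] g -> (forall z, 0 <= g z) ->
          \int[pi]_z g z = \sum_(i < k)
            ((a i)%:E * \int[mu]_(x in A i) g (x : T, y i) +
             (1 - a i)%:E * \int[mu]_(x in A i) g (x : T, x0)),
        forall S : set (borel T), measurable S -> pi (fst @^-1` S) = mu S &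
        forall S : set (borel T), measurable S ->
          pi (snd @^-1` S) = \sum_(i < k)
            ((a i * fine (mu (A i)) * \1_S (y i))%:E +
             ((1 - a i) * fine (mu (A i)) * \1_S x0)%:E)].
Proof.
have law v := probability_map mu (measurable_pairl v).
pose Q v : probability (borel (T * T)%type) R := s2val (cid2 (law v)).
have QP v (D : set (borel (T * T)%type)) (g : borel (T * T)%type -> \bar R) :
    measurable D -> measurable_fun [set: borel (T * T)%type] g ->
    (forall z, 0 <= g z) ->
    \int[Q v]_(z in D) g z = \int[mu]_(x in (fun x => (x : T, v)) @^-1` D) g (x : T, v).
  exact: (s2valP' (cid2 (law v))).
pose B i : set (borel (T * T)%type) := fst @^-1` A i.
have mB i : measurable (B i).
  by rewrite -[B i]setTI; exact: (@measurable_borel_fst R T).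
have a0 i : (0 <= a i)%R by case/andP: (a01 i).
have a1 i : (0 <= 1 - a i)%R by rewrite subr_ge0; case/andP: (a01 i).
have [m1 m1E] := mixture_measure (fun i => Q (y i)) k mB a0.
have [m2 m2E] := mixture_measure (fun=> Q x0) k mB a1.
have mE (g : borel (T * T)%type -> \bar R) :
    measurable_fun [set: borel (T * T)%type] g -> (forall z, 0 <= g z) ->
    \int[measure_add m1 m2]_z g z = \sum_(i < k)
      ((a i)%:E * \int[mu]_(x in A i) g (x : T, y i) +
       (1 - a i)%:E * \int[mu]_(x in A i) g (x : T, x0)).
  move=> mg g0; rewrite ge0_integral_measure_add// m1E// m2E// -big_split /=.
  by apply: eq_bigr => i _; rewrite !QP.
(* The shares [a i] and [1 - a i] add up to [1], so the first marginal is [mu]; the constant [1]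
   then gives total mass [1]. *)
have mfst (g : borel T -> \bar R) :
    measurable_fun [set: borel T] g -> (forall x, 0 <= g x) ->
    \int[measure_add m1 m2]_z g (z : T * T).1 = \int[mu]_x g x.
  move=> mg g0.
  have mg1 := measurableT_comp mg (@measurable_borel_fst R T).
  rewrite (mE _ mg1); last by move=> z; exact: g0.
  apply: etrans _ (esym (ge0_integral_partition mg g0)).
  apply: eq_bigr => i _ /=; rewrite -ge0_muleDl ?lee_fin//.
  by rewrite -EFinD addrC subrK mul1e.
have mT : measure_add m1 m2 setT = 1.
  have := mfst (cst 1) (measurable_cst _) (fun=> lee01).
  rewrite /= !integral_cst// !mul1e => h; exact: etrans h (probability_setT mu).
have [pi piE] := probability_of_measure (Q x0) mT.
have piI (g : borel (T * T)%type -> \bar R) :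
    \int[pi]_z g z = \int[measure_add m1 m2]_z g z.
  by apply: eq_measure_integral => D _ _; rewrite -piE.
have pi1 (D : set (borel (T * T)%type)) : measurable D ->
    pi D = \int[measure_add m1 m2]_z (\1_D z)%:E.
  by move=> mD; rewrite -piI integral_indic// setIT.
have indic_ge0 d (X : measurableType d) (S : set X) (x : X) : 0 <= (\1_S x : R)%:E.
  by rewrite lee_fin.
have mind d (X : measurableType d) (S : set X) : measurable S ->
    measurable_fun [set: X] (fun x => (\1_S x : R)%:E).
  by move=> mS; apply/measurable_EFinP; exact: measurable_indic.
exists pi; split => [g mg g0|S mS|S mS].
- by rewrite piI; exact: mE.
- rewrite pi1; last by rewrite -[X in measurable X]setTI; exact: measurable_borel_fst.
  apply: etrans (mfst _ (mind _ _ _ mS) _) _ => //.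
  by rewrite integral_indic// setIT.
- have mS2 : measurable (snd @^-1` S : set (borel (T * T)%type)).
    by rewrite -[X in measurable X]setTI; exact: measurable_borel_snd.
  rewrite pi1// mE//; last exact: mind.
  apply: eq_bigr => i _.
  (* The second coordinate is fixed on each piece, so the indicator is a constant there. *)
  rewrite [X in _ * X + _](_ : _ = \int[mu]_(x in A i) (\1_S (y i))%:E)//.
  rewrite [X in _ + _ * X](_ : _ = \int[mu]_(x in A i) (\1_S x0)%:E)//.
  rewrite !integral_cst// -[X in _ * (_ * X) + _]fineK ?fin_num_measure//.
  rewrite -[X in _ + _ * (_ * X)]fineK ?fin_num_measure// -!EFinM.
  by congr (_%:E + _%:E); rewrite mulrA mulrAC.
Qed.

End mixture_coupling.

Section quantizer.
Context (R : realType) (T : pmetricType R) (p : R) (p1 : 1 <= p) (x0 : T).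
Local Open Scope ereal_scope.

Let p0 : (0 < p)%R. Proof. exact: lt_le_trans p1. Qed.

(** If [mdist x x0] is at least [2k], it is at most twice its excess over [k]. Hence this weight
    dominates the [p]-th power of the distance far out, and its integral is [2 ^ p] times that of
    the [p]-th power of the excess. *)
Definition tail_weight (k : nat) (x : T) : R := ((2 * excess x0 k x) `^ p)%R.

Lemma tail_weight_ge0 k x : (0 <= tail_weight k x)%R.
Proof. exact: powR_ge0. Qed.

Lemma measurable_tail_weight k :
  measurable_fun [set: borel T] (tail_weight k : borel T -> R).
Proof.
apply: measurable_fun_powR; apply: measurable_funM; first exact: measurable_cst.
exact: measurable_excess.
Qed.

Lemma tail_weight_le k x : (tail_weight k x <= 2 `^ p * mdist x x0 `^ p)%R.
Proof.
rewrite -powRM ?mdist_ge0//; apply: ge0_ler_powR => //; first exact: ltW.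
- by rewrite nnegrE mulr_ge0// excess_ge0.
- by rewrite nnegrE mulr_ge0// mdist_ge0.
- by rewrite ler_wpM2l// /excess ge_max mdist_ge0 andbT gerBl ler0n.
Qed.

Lemma far_le_tail_weight n x : (n.+1%:R < mdist x x0)%R ->
  (mdist x x0 `^ p <= tail_weight n./2 x)%R.
Proof.
move=> nx; apply: ge0_ler_powR => //; first exact: ltW.
- by rewrite nnegrE mdist_ge0.
- by rewrite nnegrE mulr_ge0// excess_ge0.
- have : (mdist x x0 - n./2%:R <= excess x0 n./2 x)%R by rewrite /excess le_max lexx.
  have : ((n./2).*2%:R <= n%:R :> R)%R.
    by rewrite ler_nat -[leqRHS]odd_double_half leq_addl.
  rewrite -mul2n natrM; rewrite -natr1 in nx; lra.
Qed.

Lemma Pp_tail_weight_lty (mu : Pp T p) k : \int[mu]_x (tail_weight k (x : T))%:E < +oo.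
Proof.
apply: (@le_lt_trans _ _ (\int[mu]_x ((2 `^ p)%:E * (mdist (x : T) x0 `^ p)%:E))).
  apply: ge0_le_integral => //.
  - by move=> x _; rewrite lee_fin tail_weight_ge0.
  - by apply/measurable_EFinP; exact: measurable_tail_weight.
  - by apply: measurable_funeM; exact: measurable_mdist_powR.
  - by move=> x _; rewrite -EFinM lee_fin; exact: tail_weight_le.
rewrite ge0_integralZl_EFin ?powR_ge0//; last 2 first.
- by move=> x _; rewrite lee_fin powR_ge0.
- exact: measurable_mdist_powR.
by rewrite lte_mul_pinfty ?lee_fin ?powR_ge0//; exact: Pp_moment_point.
Qed.

Lemma finite_quantizer n : proper_metric T ->
  exists2 d : Pp T p -> Pp T p, finite_set (range d) &
    forall mu : Pp T p, exists2 pi, couplings mu (d mu) pi &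
      \int[pi]_(z in [set: T * T]) (mdist z.1 z.2 `^ p)%:E <=
        (2 / n.+1%:R)%:E + \int[mu]_x (tail_weight n./2 (x : T))%:E.
Proof.
move=> pT.
have n0 : (0 < n.+1%:R^-1 :> R)%R by rewrite invr_gt0.
have [k [A [y [mA tA cA Ay]]]] := proper_partition x0 pT (ltr0Sn R n) n0.
(* The largest cost of moving a unit of mass to [x0] from within the ball of radius [n + 1]. *)
pose C : R := (n.+1%:R `^ p)%R.
have C0 : (0 <= C)%R by exact: powR_ge0.
(* Rounding loses at most [1 / m] in each of the [k] cells; this [m] makes the total cost of the
   lost mass, [k * C / m], at most [1 / (n + 1)]. *)
pose m := (Num.truncn (k%:R * C * n.+1%:R)).+1.
have m0 : (0 < m%:R :> R)%R by rewrite ltr0n.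
have mC : (k%:R * C / m%:R <= n.+1%:R^-1)%R.
  by rewrite ler_pdivrMr// [leRHS]mulrC ler_pdivlMr// ltW// truncnS_gt.
pose v (mu : Pp T p) i : R := fine (mu (A i)).
have v0 mu i : (0 <= v mu i)%R by rewrite fine_ge0.
have v1 mu i : (v mu i <= 1)%R.
  by rewrite -lee_fin fineK ?fin_num_measure// probability_le1.
have sum_v mu : (\sum_(i < k) v mu i = 1)%R.
  apply: EFin_inj; rewrite -sumEFin.
  transitivity (\sum_(i < k) \int[mu]_(x in A i) cst 1 x).
    by apply: eq_bigr => i _; rewrite integral_cst// mul1e /v fineK ?fin_num_measure.
  rewrite -(ge0_integral_partition mu mA tA cA (measurable_cst _) (fun=> lee01)).
  by rewrite integral_cst// mul1e; exact: probability_setT.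
pose q (mu : Pp T p) i := Num.truncn (m%:R * v mu i).
have q_le mu i : ((q mu i)%:R / m%:R <= v mu i)%R.
  by rewrite ler_pdivrMr// mulrC truncn_le mulr_ge0.
have q_gt mu i : (v mu i - (q mu i)%:R / m%:R <= m%:R^-1)%R.
  rewrite lerBlDr -[X in (_ <= X + _)%R]mul1r -mulrDl ler_pdivlMr// mulrC nat1r.
  exact/ltW/truncnS_gt.
have q_m mu i : (q mu i < m.+1)%N.
  rewrite ltnS -(ler_nat R) -[leRHS]mul1r -ler_pdivrMr//.
  exact: le_trans (q_le mu i) (v1 mu i).
(* The share of the cell for which exactly the rounded mass [q / m] reaches the centre. *)
pose a mu i : R := ((q mu i)%:R / m%:R / v mu i)%R.
(* This includes the cells of mass [0], where [a] is [0 / 0 = 0]. *)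
have av mu i : (a mu i * v mu i = (q mu i)%:R / m%:R)%R.
  have [vi0|vi0] := eqVneq (v mu i) 0%R; last by rewrite divfK.
  by rewrite vi0 mulr0 /q vi0 mulr0 truncn0 mul0r.
have a01 mu i : (0 <= a mu i <= 1)%R.
  rewrite divr_ge0 ?divr_ge0 ?v0//=.
  have [vi0|vi0] := eqVneq (v mu i) 0%R; first by rewrite /a vi0 invr0 mulr0.
  by rewrite ler_pdivrMr ?mul1r// lt_neqAle eq_sym vi0 v0.
have piP (mu : Pp T p) := mixture_coupling mu y x0 mA tA cA (a01 mu).
pose W (x : borel T) := (tail_weight n./2 (x : T))%:E.
have mW : measurable_fun [set: borel T] W.
  by apply/measurable_EFinP; exact: measurable_tail_weight.
have W0 x : 0 <= W x by rewrite lee_fin tail_weight_ge0.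
have cost_le (mu : Pp T p) (pi : probability (borel (T * T)%type) R) :
    (forall g : borel (T * T)%type -> \bar R,
          measurable_fun [set: borel (T * T)%type] g -> (forall z, 0 <= g z) ->
          \int[pi]_z g z = \sum_(i < k)
            ((a mu i)%:E * \int[mu]_(x in A i) g (x : T, y i) +
             (1 - a mu i)%:E * \int[mu]_(x in A i) g (x : T, x0))) ->
    \int[pi]_(z in [set: T * T]) (mdist z.1 z.2 `^ p)%:E <=
      (2 / n.+1%:R)%:E + \int[mu]_x W x.
  move=> piE; rewrite piE; last 2 first.
  - exact: measurable_cost.
  - by move=> z; rewrite lee_fin powR_ge0.
  have bound i (f : borel T -> R) (c : R) : (0 <= c)%R ->
      measurable_fun [set: borel T] f -> (forall x, 0 <= f x)%R ->
      (forall x, A i x -> f x <= c + tail_weight n./2 x)%R ->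
      \int[mu]_(x in A i) (f x)%:E <= (c * v mu i)%:E + \int[mu]_(x in A i) W x.
    move=> c0 mf f0 fc.
    have -> : (c * v mu i)%:E = \int[mu]_(x in A i) (cst c%:E x).
      by rewrite integral_cst// EFinM /v fineK ?fin_num_measure.
    rewrite -ge0_integralD//; last exact: measurable_funTS.
    apply: ge0_le_integral => //.
    - by move=> x _; rewrite lee_fin.
    - by apply: measurable_funTS; exact/measurable_EFinP.
    - by apply: emeasurable_funD => //; exact: measurable_funTS.
  have Wfin i : \int[mu]_(x in A i) W x \is a fin_num.
    rewrite ge0_fin_numE; last by apply: integral_ge0.
    apply: le_lt_trans (Pp_tail_weight_lty mu n./2).
    by apply: ge0_subset_integral.
  pose w i := fine (\int[mu]_(x in A i) W x).
  have term i : (i < k)%N ->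
     (a mu i)%:E * \int[mu]_(x in A i) (mdist (x : T) (y i) `^ p)%:E +
     (1 - a mu i)%:E * \int[mu]_(x in A i) (mdist (x : T) x0 `^ p)%:E <=
     (n.+1%:R^-1 * v mu i + C / m%:R + w i)%:E.
    move=> ik.
    have /andP[ai0 ai1] := a01 mu i.
    have near_bound : \int[mu]_(x in A i) (mdist (x : T) (y i) `^ p)%:E <=
        (n.+1%:R^-1 * v mu i + w i)%:E.
      rewrite EFinD /w fineK//; apply: bound; first exact: ltW.
      - apply: measurable_fun_powR; apply: measurable_continuous1.
        exact: continuous_mdistl.
      - by move=> x; exact: powR_ge0.
      - move=> x /(Ay i x ik)[xy|[-> xx0]]; last first.
          by apply: le_trans (far_le_tail_weight xx0) _; rewrite lerDr ltW.
        (* The mesh is at most [1], so for [1 <= p] its [p]-th power is at most the mesh. *)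
        apply: (@le_trans _ _ n.+1%:R^-1%R); last by rewrite lerDl tail_weight_ge0.
        apply: (@le_trans _ _ (n.+1%:R^-1 `^ p)%R).
          by apply: ge0_ler_powR; rewrite ?nnegrE ?mdist_ge0 ?(ltW p0) ?(ltW n0) ?(ltW xy).
        by apply: ge1r_powR => //; rewrite n0 invf_le1// ler1n.
    have far_bound : \int[mu]_(x in A i) (mdist (x : T) x0 `^ p)%:E <=
        (C * v mu i + w i)%:E.
      rewrite EFinD /w fineK//; apply: bound => //.
      - apply: measurable_fun_powR; apply: measurable_continuous1.
        exact: continuous_mdistl.
      - by move=> x; exact: powR_ge0.
      - move=> x _; have [xn|xn] := leP (mdist x x0) n.+1%:R.
          apply: ler_wpDr; first exact: tail_weight_ge0.
          by apply: ge0_ler_powR; rewrite ?nnegrE ?mdist_ge0 ?(ltW p0).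
        by apply: le_trans (far_le_tail_weight xn) _; rewrite lerDr.
    apply: le_trans (leeD (lee_wpmul2l _ near_bound) (lee_wpmul2l _ far_bound)) _.
    - by rewrite lee_fin.
    - by rewrite lee_fin subr_ge0.
    rewrite -!EFinM -EFinD lee_fin.
    (* The tail terms recombine into one [w i], and the factor of [C] is the rounding error
       [v - q / m]. *)
    have -> : (a mu i * (n.+1%:R^-1 * v mu i + w i) +
       (1 - a mu i) * (C * v mu i + w i) =
       n.+1%:R^-1 * (a mu i * v mu i) + C * (v mu i - a mu i * v mu i) + w i)%R.
      by ring.
    rewrite lerD2r av lerD// ?ler_wpM2l// ltW//.
  apply: (@le_trans _ _ (\sum_(i < k) (n.+1%:R^-1 * v mu i + C / m%:R + w i)%:E)).
    by apply: lee_sum => i _; exact: term.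
  have -> : \int[mu]_x W x = (\sum_(i < k) w i)%:E.
    rewrite (ge0_integral_partition mu mA tA cA)// -sumEFin.
    by apply: eq_bigr => i _; rewrite /w fineK.
  (* The cell masses sum to [1], so mesh and rounding contribute at most [1 / (n + 1)] each. *)
  rewrite sumEFin -EFinD lee_fin !big_split /= lerD2r -mulr_sumr sum_v mulr1.
  rewrite sumr_const card_ord [leRHS]mulr_natl mulr2n lerD2l.
  by rewrite -[leLHS]mulr_natl mulrA.
have exists_nu (mu : Pp T p) : exists nu : Pp T p,
    (exists2 pi, couplings mu nu pi &
      \int[pi]_(z in [set: T * T]) (mdist z.1 z.2 `^ p)%:E <=
        (2 / n.+1%:R)%:E + \int[mu]_x W x) /\
    forall S : set (borel T), measurable S ->
      nu S = \sum_(i < k) (((q mu i)%:R / m%:R * \1_S (y i))%:E +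
               ((v mu i - (q mu i)%:R / m%:R) * \1_S x0)%:E).
  have [pi [piE pi1 pi2]] := piP mu.
  have [P PE Pint] := probability_map pi (@measurable_borel_snd R T).
  (* Values on non-Borel sets are reset to [0], as [Pp] demands. *)
  have [P' P'E P'0] := borel_restr P.
  have cpi : couplings mu P' pi.
    by split => // S mS; apply: esym; exact: (etrans (P'E S mS) (PE S)).
  have P'mom : \int[P']_x (mdist (x : T) x0 `^ p)%:E < +oo.
    rewrite -(integral_coupling_snd cpi (measurable_mdist_powR p x0)); last first.
      by move=> x; rewrite lee_fin powR_ge0.
    apply: (@ge0_le_integral_powR2 R p p1 _ _ pi _
      (fun z : borel (T * T)%type => mdist (z : T * T).1 (z : T * T).2)
      (fun z : borel (T * T)%type => mdist (z : T * T).1 x0)) => //;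
      try by move=> x; exact: mdist_ge0.
    - apply: (measurableT_comp (f := fun x : borel T => mdist (x : T) x0) _
        (@measurable_borel_snd R T)).
      by apply: measurable_continuous1; exact: continuous_mdistl.
    - by apply: measurable_continuous2; exact: continuous_mdist.
    - apply: (measurableT_comp (f := fun x : borel T => mdist (x : T) x0) _
        (@measurable_borel_fst R T)).
      by apply: measurable_continuous1; exact: continuous_mdistl.
    - by move=> x; rewrite (metric_sym x.1 x.2); exact: metric_triangle.
    - apply: le_lt_trans (cost_le mu pi piE) _.
      by rewrite lte_add_pinfty ?ltry//; exact: Pp_tail_weight_lty.
    - rewrite (integral_coupling_fst cpi (measurable_mdist_powR p x0)).
        exact: Pp_moment_point.
      by move=> x; rewrite lee_fin powR_ge0.
  exists (@Build_Pp R T p P' (ex_intro _ x0 P'mom) P'0); split.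
    by exists pi => //; exact: cost_le.
  move=> S mS; apply: etrans (P'E S mS) _; apply: etrans (PE S) _.
  rewrite pi2//; apply: eq_bigr => i _; rewrite av.
  by congr (_ + (_ * _)%:E); rewrite mulrBl mul1r av.
pose d (mu : Pp T p) := sval (cid (exists_nu mu)).
have dP (mu : Pp T p) := svalP (cid (exists_nu mu)).
exists d; last by move=> mu; exact: (dP mu).1.
(* The rounded masses form a function from [k] cells to the integers up to [m], and they determine
   [d mu]. *)
have := @finite_range_factor _ _ _
  (fun mu : Pp T p => [ffun i : 'I_k => Ordinal (q_m mu i)]) d.
apply=> mu mu' /ffunP qq.
have {}qq (i : 'I_k) : q mu i = q mu' i.
  by have := qq i; rewrite !ffunE => /(congr1 val).
apply: Pp_ext => S mS; rewrite (dP mu).2// (dP mu').2//.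
rewrite !big_split /=; congr (_ + _).
  by apply: eq_bigr => i _; rewrite qq.
(* The leftover at [x0] totals [1] minus the rounded masses, so the exact masses [v] drop out. *)
rewrite !sumEFin -!mulr_suml !sumrB !sum_v.
by under eq_bigr do rewrite qq.
Qed.

End quantizer.

(** * Input-EDAP of Wasserstein spaces *)

Lemma wasserstein_input_EDAP (R : realType) (K : numFieldType) (absK : K -> R)
    (T : pmetricType R) (p : R) :
  proper_metric T -> 1 <= p -> input_EDAP absK (@wasserstein R T p).
Proof.
move=> pT p1; have p0 : 0 < p by exact: lt_le_trans p1.
pose x0 : T := point.
have dP n := cid2 (finite_quantizer p1 x0 n pT).
apply: (@finite_range_input_EDAP _ _ _ _ _ (fun n => s2val (dP n))).
- by move=> mu nu; exact: wasserstein_ge0.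
- by move=> n; exact: s2valP (dP n).
move=> A cA e e0.
(* The factor [2] in [tail_weight] turns [e / 4] into [e / 2], whose [p]-th power is at most
   [e ^ p / 2]; the other half of [e ^ p] is left for [2 / (n + 1)]. *)
have e4 : 0 < e / 4 by rewrite divr_gt0.
have [k kA] := compact_tail p1 x0 pT cA e4.
have ep : 0 < e `^ p by exact: powR_gt0.
near=> n => mu Amu.
have [pi cpi pi_le] := s2valP' (dP n) mu.
apply: (wasserstein_le p1 (ltW e0) cpi); apply: le_trans pi_le _.
have tail_lt : (\int[mu]_x (excess x0 n./2 (x : T) `^ p)%:E < ((e / 4) `^ p)%:E)%E.
  rewrite poweRV_ltP ?(ltW e4)//; last first.
    by apply: integral_ge0 => x _; rewrite lee_fin powR_ge0.
  apply: le_lt_trans (le_tail p1 x0 mu (_ : (k <= n./2)%N)) (kA mu Amu).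
  by rewrite -(doubleK k); apply: half_leq; near: n; exists k.*2.
have -> : (\int[mu]_x (tail_weight p x0 n./2 (x : T))%:E =
    (2 `^ p)%:E * \int[mu]_x (excess x0 n./2 (x : T) `^ p)%:E)%E.
  rewrite -ge0_integralZl_EFin ?powR_ge0//.
  - apply: eq_integral => x _.
    by rewrite /tail_weight powRM ?excess_ge0.
  - by move=> x _; rewrite lee_fin powR_ge0.
  - apply/measurable_EFinP; apply: measurable_fun_powR; exact: measurable_excess.
have half_le : 2 `^ p * (e / 4) `^ p <= e `^ p / 2.
  rewrite -powRM ?(ltW e4)// (_ : 2 * (e / 4) = e * 2^-1); last by field.
  rewrite powRM ?(ltW e0)// ler_wpM2l ?(ltW ep)//.
  by apply: ge1r_powR => //; rewrite invr_gt0 invf_le1 ?ler1n ?ltr0n.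
apply: (@le_trans _ _ ((e `^ p / 2)%:E + (e `^ p / 2)%:E)%E); last first.
  by rewrite -EFinD -splitr.
apply: leeD.
  rewrite lee_fin ler_pdivrMr ?ltr0n// -ler_pdivrMl ?divr_gt0//.
  apply/ltW/(lt_le_trans (truncnS_gt _)); rewrite ler_nat.
  by rewrite ltnS; near: n; exact: nbhs_infty_ge.
apply: (@le_trans _ _ ((2 `^ p)%:E * ((e / 4) `^ p)%:E)%E).
  by apply: lee_wpmul2l; [rewrite lee_fin powR_ge0|exact: ltW].
by rewrite -EFinM lee_fin.
Unshelve. all: by end_near. Qed.

Theorem theorem3p39 (R : realType) (Omega : pmetricType R) (p : R) :
  proper_metric Omega -> 1 <= p ->
  input_EDAP (K := R) Num.norm (@wasserstein R Omega p) /\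
  input_EDAP (K := R[i]) (@ComplexField.Normc.normc R) (@wasserstein R Omega p).
Proof. by move=> pO p1; split; exact: wasserstein_input_EDAP. Qed.
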